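(* Consider the VNF-node placement and capacity allocation problem P1 (defined in the context). The RP-GCA algorithm (defined in the context) outputs a feasible solution $(\mathcal{U},\boldsymbol{\lambda})$ whose value $J_1(\mathcal{U},\boldsymbol{\lambda})$ is at least $\frac13(1-1/e)\,OPT(P1)$, where $OPT(P1)$ is the optimal value of P1; i.e., RP-GCA has approximation ratio $\frac13(1-1/e)$ for P1.
   Context: Data: finite node set $\mathcal{V}$; finite flow set $\mathcal{F}$; each flow $f$ has rate $\lambda_f>0$ and path node set $\mathcal{V}_f\subseteq\mathcal{V}$; each node $v$ has capacity $c_v>0$ and cost $b_v>0$; budget $B$; it is assumed $\max_f\lambda_f\le\min_v c_v$. Problem P1: maximize $J_1(\mathcal{U},\boldsymbol{\lambda})=\sum_{f\in\mathcal{F}}\lambda_f\mathbf{1}\{\sum_{v\in\mathcal{V}_f\cap\mathcal{U}}\lambda_f^v\ge\lambda_f\}$ over $\mathcal{U}\subseteq\mathcal{V}$ and nonnegative $\boldsymbol{\lambda}=(\lambda_f^v)$ subject to $\sum_f\lambda_f^v\le c_v$ for $v\in\mathcal{U}$, $\lambda_f^v=0$ for $v\notin\mathcal{U}$, and $\sum_{v\in\mathcal{U}}b_v\le B$. Relaxed value: $R_3(\mathcal{U})$ is the optimal value of: maximize $\sum_f\sum_{v\in\mathcal{V}_f\cap\mathcal{U}}\lambda_f^v$ over nonnegative $\boldsymbol{\lambda}$ with the same capacity constraints, $\lambda_f^v=0$ for $v\notin\mathcal{U}$, and $\sum_{v\in\mathcal{U}}\lambda_f^v\le\lambda_f$ for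 all $f$. RP-GCA: (1) Placement: choose $\mathcal{U}$ by approximately maximizing $R_3(\mathcal{U})$ subject to $\sum_{v\in\mathcal{U}}b_v\le B$; if all costs equal $b$, use Submodular Greedy (start from $\emptyset$ and $\lfloor B/b\rfloor$ times add a node with the largest marginal increase of $R_3$, ties broken uniformly at random); in general use Enumeration-based Greedy: let $\mathcal{U}_1$ be the best (largest $R_3$) budget-feasible subset of cardinality one or two; for each budget-feasible subset of cardinality three, greedily augment it by repeatedly adding a node $u$ maximizing $(R_3(\mathcal{V}'\cup\{u\})-R_3(\mathcal{V}'))/b_u$ among those keeping the budget satisfied, and let $\mathcal{U}_2$ be the best augmented set; output the better of $\mathcal{U}_1,\mathcal{U}_2$. (2) Capacity allocation by GCA: with $\mathcal{U}_f=\mathcal{V}_f\cap\mathcal{U}$, $\mathcal{F}_{\mathcal{U}}=\{f:\mathcal{U}_f\ne\emptyset\}$ and remaining capacities $c'_v$ (initially $c_v$), sort $\mathcal{F}_{\mathcal{U}}$ by nonincreasing rate; Phase I: for each flow in order, if some $v\in\mathcal{U}_f$ has $c'_v\ge\lambda_f$, assign $f$ entirely to one such $v$ and reduce $c'_v$ by $\lambda_f$; Phase II: for each unassigned flow in sorted order, if $\sum_{v\in\mathcal{U}_f}c'_v\ge\lambda_f$, split $f$ and fully assign it to nodes of $\mathcal{U}_f$ using remaining capacities. *)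

(* Defs.v *)
From HB Require Import structures.
From mathcomp Require Import all_boot all_order all_algebra.
From mathcomp Require Import all_classical all_reals all_analysis.
Set Implicit Arguments. Unset Strict Implicit. Unset Printing Implicit Defensive.
Import Order.TTheory GRing.Theory Num.Theory.
Local Open Scope ring_scope.
Local Open Scope classical_set_scope.

Section VNF.
Context {V F : finType} {R : realType}.
(* path node sets, flow rates, node capacities, node costs, budget *)
Variables (path : F -> {set V}) (rate : F -> R) (c b : V -> R) (B : R).

Definition cost (U : {set V}) : R := \sum_(v in U) b v.

Definition J1 (U : {set V}) (lam : F -> V -> R) : R :=
  \sum_(f : F) (if rate f <= \sum_(v in path f :&: U) lam f v then rate f else 0).

Definition feasibleP1 (U : {set V}) (lam : F -> V -> R) : Prop :=
  [/\ forall f v, 0 <= lam f v,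
      forall v, v \in U -> \sum_(f : F) lam f v <= c v,
      forall f v, v \notin U -> lam f v = 0
    & cost U <= B].

Definition OPT : R :=
  sup [set x | exists U lam, feasibleP1 U lam /\ x = J1 U lam].

Definition feasibleR3 (U : {set V}) (lam : F -> V -> R) : Prop :=
  [/\ forall f v, 0 <= lam f v,
      forall v, v \in U -> \sum_(f : F) lam f v <= c v,
      forall f v, v \notin U -> lam f v = 0
    & forall f, \sum_(v in U) lam f v <= rate f].

Definition R3 (U : {set V}) : R :=
  sup [set x | exists lam, feasibleR3 U lam /\
                 x = \sum_(f : F) \sum_(v in path f :&: U) lam f v].

(* one greedy step: add a node of maximal marginal gain (any maximizer,
   modelling uniformly random tie-breaking) *)
Definition sg_step (U U' : {set V}) : Prop :=
  exists u, [/\ u \notin U, U' = u |: U &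
    forall w, w \notin U -> R3 (w |: U) - R3 U <= R3 U' - R3 U].

Inductive sg_out : nat -> {set V} -> {set V} -> Prop :=
| sg_done (U : {set V}) : sg_out 0 U U
| sg_full k (U : {set V}) : U = finset.setT -> sg_out k.+1 U U
| sg_next k (U U' W : {set V}) : sg_step U U' -> sg_out k U' W -> sg_out k.+1 U W.

Definition aug_step (U U' : {set V}) : Prop :=
  exists u, [/\ u \notin U, cost (u |: U) <= B, U' = u |: U &
    forall w, w \notin U -> cost (w |: U) <= B ->
      (R3 (w |: U) - R3 U) / b w <= (R3 U' - R3 U) / b u].

Inductive aug_out : {set V} -> {set V} -> Prop :=
| aug_stop (U : {set V}) : (forall w : V, w \notin U -> B < cost (w |: U)) -> aug_out U U
| aug_next (U U' W : {set V}) : aug_step U U' -> aug_out U' W -> aug_out U W.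

Definition small_feas (S : {set V}) : Prop :=
  ((#|S| == 1)%N || (#|S| == 2)%N) /\ cost S <= B.

Definition three_feas (S : {set V}) : Prop := #|S| = 3%N /\ cost S <= B.

Definition is_U1 (U1 : {set V}) : Prop :=
  (small_feas U1 /\ forall S, small_feas S -> R3 S <= R3 U1)
  \/ ((forall S, ~ small_feas S) /\ U1 = finset.set0).

Definition is_U2 (U2 : {set V}) : Prop :=
  (exists g : {set V} -> {set V},
     (forall S, three_feas S -> aug_out S (g S)) /\
     exists S0, [/\ three_feas S0, U2 = g S0 &
                    forall S, three_feas S -> R3 (g S) <= R3 U2])
  \/ ((forall S, ~ three_feas S) /\ U2 = finset.set0).

Definition eg_out (U : {set V}) : Prop :=
  exists U1 U2, [/\ is_U1 U1, is_U2 U2 &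
     (U = U1 /\ R3 U2 <= R3 U1) \/ (U = U2 /\ R3 U1 <= R3 U2)].

Definition equal_costs : Prop := exists b0, forall v, b v = b0.

Definition placement (U : {set V}) : Prop :=
  (exists b0, (forall v, b v = b0) /\ sg_out (Num.truncn (B / b0)) finset.set0 U)
  \/ (~ equal_costs /\ eg_out U).

Record gstate := GState { glam : F -> V -> R; gcap : V -> R; gasg : F -> bool }.

Definition gca_init : gstate := GState (fun _ _ => 0) c (fun _ => false).

Definition phase1_step (U : {set V}) (f : F) (s s' : gstate) : Prop :=
  (exists v, [/\ v \in path f :&: U, rate f <= gcap s v &
     s' = GState (fun g w => if (g == f) && (w == v) then rate f else glam s g w)
                 (fun w => if w == v then gcap s v - rate f else gcap s w)
                 (fun g => (g == f) || gasg s g)])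
  \/ ((forall v, v \in path f :&: U -> gcap s v < rate f) /\ s' = s).

Definition phase2_step (U : {set V}) (f : F) (s s' : gstate) : Prop :=
  (gasg s f /\ s' = s)
  \/ (~~ gasg s f /\ rate f <= \sum_(v in path f :&: U) gcap s v /\
      exists x : V -> R,
        [/\ forall v, 0 <= x v, forall v, x v <= gcap s v,
            forall v, v \notin path f :&: U -> x v = 0,
            \sum_(v : V) x v = rate f &
            s' = GState (fun g w => if g == f then x w else glam s g w)
                        (fun w => gcap s w - x w)
                        (fun g => (g == f) || gasg s g)])
  \/ (~~ gasg s f /\ \sum_(v in path f :&: U) gcap s v < rate f /\ s' = s).

Inductive run (step : F -> gstate -> gstate -> Prop) :
  seq F -> gstate -> gstate -> Prop :=
| run_nil s : run step [::] s s
| run_cons f fs s s' s'' : step f s s' -> run step fs s' s'' -> run step (f :: fs) s s''.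

Definition served_flows (U : {set V}) : pred F := [pred f | path f :&: U != finset.set0].

Definition gca_out (U : {set V}) (lam : F -> V -> R) : Prop :=
  exists (order : seq F) (s1 s2 : gstate),
    [/\ perm_eq order (enum (served_flows U)),
        sorted (fun f g => rate g <= rate f) order,
        run (phase1_step U) order gca_init s1,
        run (phase2_step U) order s1 s2 &
        lam = glam s2].

Definition rp_gca_out (U : {set V}) (lam : F -> V -> R) : Prop :=
  placement U /\ gca_out U lam.

End VNF.

(* Main.v *)
(* By max-flow min-cut, the relaxed value R3 U is the minimum over W included in
   U of c(U \ W) + rate(N(W)), where N(W) is the set of flows meeting W. Hence R3
   is monotone and submodular, and it dominates J1, so both greedy placements
   reach (1 - 1/e) OPT in terms of R3: the uniform one by Nemhauser, Wolsey and
   Fisher's argument, the enumerative one by Sviridenko's. The allocation loses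
   at most a factor 3: a node met by an unserved flow is at least half full after
   Phase I, so cutting at these nodes bounds R3 U by 2 J1 + J1. *)
Require Import Defs.
From HB Require Import structures.
From mathcomp Require Import all_boot all_order all_algebra.
From mathcomp Require Import all_classical all_reals all_analysis.
From mathcomp Require Import ring lra.
Set Implicit Arguments. Unset Strict Implicit. Unset Printing Implicit Defensive.
(* Repeated so that the names shared with [classical_sets] denote the finite-set lemmas. *)
From mathcomp Require Import fintype finset.
Import Order.TTheory GRing.Theory Num.Theory.
Import numFieldNormedType.Exports.
Local Open Scope ring_scope.

(** * Preliminaries on finite sums, continuity and the exponential *)

Lemma sum_le_subset (T : finType) (R : numDomainType) (A B : {set T}) (x : T -> R) :
  (forall i, 0 <= x i) -> A \subset B -> \sum_(i in A) x i <= \sum_(i in B) x i.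
Proof.
move=> x0 AB; rewrite [leRHS](big_setID A) /= (setIidPr AB) lerDl.
by apply: sumr_ge0 => i _.
Qed.

Lemma sum_fun_continuous (T : topologicalType) (R : realType) (I : Type)
    (r : seq I) (P : pred I) (h : I -> T -> R) :
  (forall i, continuous (h i)) -> continuous (fun x => \sum_(i <- r | P i) h i x).
Proof.
move=> hc; elim: r => [|i r IH].
  by under [X in continuous X]eq_fun do rewrite big_nil; exact: cst_continuous.
under [X in continuous X]eq_fun do rewrite big_cons.
by case: (P i) => // x; apply: cvgD; [exact: hc | exact: IH].
Qed.

(** Used to absorb the gain of at most a third of [r Y] in the enumerative greedy analysis. *)
Lemma expRN1_ge_third (R : realType) : 3^-1 <= expR (-1) :> R.
Proof.
(* Six is the least [n] with [(1 - n^-1) ^+ n >= 3^-1]. *)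
have -> : -1 = 6%:R * - 6^-1 :> R by field.
rewrite expRM_natl; apply: (@le_trans _ _ ((1 - 6^-1) ^+ 6)); first by lra.
by rewrite lerXn2r ?nnegrE ?expR_ge0 ?expR_ge1Dx //; lra.
Qed.

(** * The relaxation and its minimal cuts *)

Section Relaxation.
Context {V F : finType} {R : realType}.
Variables (path : F -> {set V}) (rate : F -> R) (c : V -> R).
Hypotheses (rate_gt0 : forall f, 0 < rate f) (c_gt0 : forall v, 0 < c v).

Definition value (U : {set V}) (lam : F -> V -> R) : R :=
  \sum_f \sum_(v in path f :&: U) lam f v.

Lemma feasibleR3_0 (U : {set V}) : feasibleR3 rate c U (fun _ _ => 0).
Proof. by split=> // *; rewrite big1 // ltW. Qed.

(** Compactness: the feasible allocations form a closed subset of a product of segments, and the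
    objective is continuous. Thus the supremum defining [R3] is attained. *)
Lemma feasibleR3_max (U : {set V}) : exists2 lam, feasibleR3 rate c U lam &
  forall lam', feasibleR3 rate c U lam' -> value U lam' <= value U lam.
Proof.
pose X := prod_topology (fun _ : F * V => R).
(* A single entry is at most the rate of its flow; off [U] the segment shrinks to zero, which
   encodes the support condition. *)
pose K : set X :=
  [set x | forall p, `[0, if p.2 \in U then rate p.1 else 0]%classic (x p)]%classic.
have Kc : compact K.
  by apply: (@tychonoff _ (fun=> R)
    (fun p : F * V => `[0, if p.2 \in U then rate p.1 else 0]%classic)) => p;
    exact: segment_compact.
have pc (p : F * V) : continuous (fun x : X => x p).
  exact: (@proj_continuous _ (fun=> R) p).
have closed_sum I (r : seq I) (P : pred I) (h : I -> F * V) (M : R) :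
    closed [set x : X | \sum_(i <- r | P i) x (h i) <= M]%classic.
  apply: (@preimage_closed _ _ (fun x : X => \sum_(i <- r | P i) x (h i)) [set y | y <= M]%classic).
    by move=> x _; apply: sum_fun_continuous => i; exact: pc.
  exact: closed_le.
pose A := (K `&` ((\bigcap_f [set x | \sum_(v in U) x (f, v) <= rate f])
  `&` (\bigcap_v [set x | \sum_f x (f, v) <= c v])))%classic.
have Ac : compact A.
  by apply: compact_closedI => //; apply: closedI; apply: closed_bigI => i _; exact: closed_sum.
have AP x : A x -> feasibleR3 rate c U (fun f v => x (f, v)).
  case=> Kx [rx cx]; split=> [f v|v _|f v vU|f].
  - by have := Kx (f, v); rewrite /= in_itv /= => /andP[].
  - exact: cx.
  - have := Kx (f, v); rewrite /= in_itv /= (negbTE vU) => ?.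
    by apply/eqP; rewrite eq_le andbC.
  - exact: rx.
have PA lam : feasibleR3 rate c U lam -> A (fun p => lam p.1 p.2).
  case=> l0 lc lU lr; split; [|split].
  - move=> [f v] /=; rewrite in_itv /= l0 /=.
    case: ifP => [vU|/negbT/lU -> //]; apply: le_trans (lr f).
    rewrite (bigD1 v) //= lerDl; exact: sumr_ge0.
  - by move=> f _ /=.
  - move=> v _ /=; have [vU|vU] := boolP (v \in U); first exact: lc.
    by rewrite big1 ?ltW // => f _; exact: lU.
have [||x] := compact_EVT_max (f := fun x : X => value U (fun f v => x (f, v))) _ Ac.
- by exists (fun p => 0); exact: (PA (fun _ _ => 0) (feasibleR3_0 U)).
- apply: continuous_subspaceT; do 2![apply: sum_fun_continuous => ?]; exact: pc.
move=> /set_mem Ax xmax; exists (fun f v => x (f, v)); first exact: AP.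
by move=> lam /PA Al; apply: (xmax (fun p => lam p.1 p.2)); exact: mem_set.
Qed.

Lemma R3_eq_max (U : {set V}) lam : feasibleR3 rate c U lam ->
  (forall lam', feasibleR3 rate c U lam' -> value U lam' <= value U lam) ->
  R3 path rate c U = value U lam.
Proof.
move=> lf lmax; apply/eqP; rewrite eq_le; apply/andP; split.
  apply: ge_sup => [|_ [l [lP ->]]]; last exact: lmax.
  by exists (value U lam); exists lam.
apply: ub_le_sup; last by exists lam.
by exists (value U lam) => _ [l [lP ->]]; exact: lmax.
Qed.

Lemma value_le_R3 (U : {set V}) lam :
  feasibleR3 rate c U lam -> value U lam <= R3 path rate c U.
Proof.
by have [m mP mmax] := feasibleR3_max U; rewrite (R3_eq_max mP mmax); apply: mmax.
Qed.

Definition nbr (W : {set V}) : {set F} := [set f | path f :&: W != set0]%SET.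

(** For [W] inside [U], this is the capacity of a cut in the network from a source through flows and
    then nodes to a sink: [W] and [nbr W] lie on the sink side, and the arcs from flows to nodes
    have infinite capacity. *)
Definition cut (U W : {set V}) : R := \sum_(v in U :\: W) c v + \sum_(f in nbr W) rate f.

Lemma notin_nbr (W : {set V}) f v : f \notin nbr W -> v \in path f -> v \notin W.
Proof. by rewrite inE negbK => /eqP/setP/(_ v); rewrite !inE => + vp; rewrite vp /= => ->. Qed.

Lemma in_nbr (W : {set V}) f v : v \in path f -> v \in W -> f \in nbr W.
Proof. by move=> vp vW; rewrite inE; apply/set0Pn; exists v; rewrite inE vp. Qed.

(** A flow avoiding [W] only uses nodes of [U :\: W] on its path. The bound involves capacities
    alone, so it serves both for weak duality and for allocations of P1. *)
Lemma sum_off_nbr_le (U W : {set V}) (lam : F -> V -> R) :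
  (forall f v, 0 <= lam f v) -> (forall v, v \in U -> \sum_f lam f v <= c v) ->
  \sum_(f | f \notin nbr W) \sum_(v in path f :&: U) lam f v <= \sum_(v in U :\: W) c v.
Proof.
move=> l0 lc; apply: (@le_trans _ _ (\sum_(f | f \notin nbr W) \sum_(v in U :\: W) lam f v)).
  apply: ler_sum => f fN; apply: sum_le_subset => //.
  by apply/subsetP => v; rewrite !inE => /andP[/(notin_nbr fN)-> ->].
rewrite exchange_big /=; apply: ler_sum => v; rewrite inE => /andP[_ vU].
apply: le_trans (lc v vU); rewrite [leRHS](bigID (fun f => f \notin nbr W)) /= lerDl.
exact: sumr_ge0.
Qed.

Lemma value_le_cut (U W : {set V}) lam :
  feasibleR3 rate c U lam -> value U lam <= cut U W.
Proof.
case=> l0 lc _ lr; rewrite /value (bigID (mem (nbr W))) /= addrC.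
apply: lerD; first exact: sum_off_nbr_le.
apply: ler_sum => f _; apply: le_trans (lr f); apply: sum_le_subset => //; exact: subsetIr.
Qed.

Lemma R3_le_cut (U W : {set V}) : R3 path rate c U <= cut U W.
Proof.
have [m mP mmax] := feasibleR3_max U; rewrite (R3_eq_max mP mmax); exact: value_le_cut.
Qed.

Definition bump (lam : F -> V -> R) (f0 : F) (v0 : V) (e : R) : F -> V -> R :=
  fun f v => lam f v + (if (f == f0) && (v == v0) then e else 0).

Lemma sum_bump_row lam f0 v0 e f (A : {set V}) :
  \sum_(v in A) bump lam f0 v0 e f v =
  \sum_(v in A) lam f v + (if (f == f0) && (v0 \in A) then e else 0).
Proof.
rewrite big_split /=; congr (_ + _); case: eqP => [_|_] /=; last by rewrite big1.
have [v0A|v0A] := boolP (v0 \in A).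
  by rewrite (bigD1 v0) //= eqxx big1 ?addr0 // => v /andP[_ /negbTE->].
by rewrite big1 // => v vA; case: eqP => // vv0; rewrite -vv0 vA in v0A.
Qed.

Lemma sum_bump_col lam f0 v0 e v :
  \sum_f bump lam f0 v0 e f v = \sum_f lam f v + (if v == v0 then e else 0).
Proof.
rewrite big_split /=; congr (_ + _).
by rewrite (bigD1 f0) //= eqxx big1 ?addr0 // => f /negbTE->.
Qed.

Lemma value_bump (U : {set V}) lam f0 v0 e : v0 \in path f0 :&: U ->
  value U (bump lam f0 v0 e) = value U lam + e.
Proof.
move=> v0P; rewrite /value; under eq_bigr do rewrite sum_bump_row.
rewrite big_split /=; congr (_ + _).
by rewrite (bigD1 f0) //= eqxx v0P big1 ?addr0 // => f /negbTE->.
Qed.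

(** Absence of short augmenting paths, in the form that turns the unsaturated nodes into a minimal
    cut. *)
Definition tight_dual (U : {set V}) lam := forall f v,
  v \in U -> \sum_f lam f v < c v -> v \in path f ->
  \sum_(v in U) lam f v = rate f /\
  forall w, w \in U -> 0 < lam f w -> \sum_f lam f w < c w.

(* A maximizer with as many unsaturated nodes as possible has no augmenting
   step: moving a little flow of [f] from a saturated node to an unsaturated one
   would make both unsaturated at no loss. *)
Lemma exists_tight (U : {set V}) : exists lam,
  [/\ feasibleR3 rate c U lam, value U lam = R3 path rate c U,
      forall f v, v \notin path f -> lam f v = 0 & tight_dual U lam].
Proof.
pose slack lam := [set v in U | \sum_(f : F) lam f v < c v]%SET.
pose good lam := [/\ feasibleR3 rate c U lam, value U lam = R3 path rate c U &
  forall f v, v \notin path f -> lam f v = 0].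
pose P n := `[< exists lam, good lam /\ #|slack lam| = n >].
have exP : exists n, P n.
  have [m mP mmax] := feasibleR3_max U.
  (* Allocation off the path of a flow does not count in the objective, so erasing it keeps a
     maximizer. *)
  pose lam f v := if v \in path f then m f v else 0.
  have lm f v : lam f v <= m f v by rewrite /lam; case: ifP => // _; case: mP.
  exists #|slack lam|; apply/asboolP; exists lam; split=> //; split.
  - case: mP => m0 mc mU mr; split=> [f v|v vU|f v vU|f].
    + by rewrite /lam; case: ifP.
    + by apply: le_trans (mc v vU); apply: ler_sum => f _.
    + by rewrite /lam mU //; case: ifP.
    + by apply: le_trans (mr f); apply: ler_sum => v _.
  - rewrite (R3_eq_max mP mmax); apply: eq_bigr => f _; apply: eq_bigr => v.
    by rewrite inE /lam => /andP[->].
  - by move=> f v /negbTE vp; rewrite /lam vp.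
have ubP n : P n -> (n <= #|V|)%N by move/asboolP => [lam [_ <-]]; exact: max_card.
have [n /asboolP[lam [lgood lcard]] nmax] := ex_maxnP exP ubP.
have [lf lval lpath] := lgood; case: (lf) => l0 lc lU lr.
exists lam; split=> // f v vU vsl vp.
have d0 : 0 < c v - \sum_f lam f v by rewrite subr_gt0.
split.
  apply/eqP; rewrite eq_le lr /= leNgt; apply/negP => fsl.
  (* If [f] were not fully served, adding the smaller of the two slacks would beat the maximum. *)
  pose e := Num.min (c v - \sum_f lam f v) (rate f - \sum_(v in U) lam f v).
  have e0 : 0 < e by rewrite lt_min d0 subr_gt0.
  have : value U (bump lam f v e) <= value U lam.
    rewrite lval; apply: value_le_R3; split=> [g w|w wU|g w wU|g].
    - by rewrite addr_ge0 //; case: ifP => // _; exact: ltW.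
    - rewrite sum_bump_col; case: eqP => [->|_]; last by rewrite addr0 lc.
      by rewrite addrC -lerBrDr ge_min lexx.
    - rewrite /bump lU // add0r; case: ifP => // /andP[_ /eqP wv].
      by rewrite wv vU in wU.
    - rewrite sum_bump_row; case: eqP => [->|_] /=; last by rewrite addr0 lr.
      by rewrite vU addrC -lerBrDr ge_min lexx orbT.
  by rewrite value_bump ?inE ?vp // gerDl leNgt e0.
move=> w wU lw; rewrite ltNge; apply/negP => wsat.
have vw : v != w by apply: contraTneq vsl => ->; rewrite -leNgt.
have wp : w \in path f by apply: contraTT lw => /lpath->; rewrite ltxx.
(* Half of the slack leaves [v] unsaturated; the bound [lam f w] keeps the entry at [w]
   nonnegative. *)
pose e := Num.min ((c v - \sum_f lam f v) / 2) (lam f w).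
have e0 : 0 < e by rewrite lt_min lw andbT divr_gt0.
have ec : e < c v - \sum_f lam f v.
  by apply: (@le_lt_trans _ _ ((c v - \sum_f lam f v) / 2)); [rewrite ge_min lexx | lra].
pose lam' := bump (bump lam f v e) f w (- e).
have col x : \sum_g lam' g x =
    \sum_g lam g x + (if x == v then e else 0) + (if x == w then - e else 0).
  by rewrite !sum_bump_col.
have slack' : slack lam' = w |: slack lam.
  apply/setP => x; rewrite !inE col.
  have [->|xw] := eqVneq x w.
    by rewrite wU /= eq_sym (negbTE vw) addr0; have := lc w wU; lra.
  rewrite addr0 /=; have [->|_] := eqVneq x v; last by rewrite addr0.
  by rewrite vU vsl addrC -ltrBrDr.
have : (#|slack lam'| <= n)%N.
  apply: nmax; apply/asboolP; exists lam'; split=> //; split.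
  - split=> [g x|x xU|g x xU|g].
    + rewrite /lam' /bump; have [->|_] := eqVneq g f; last by rewrite !addr0.
      have [->|xw] /= := eqVneq x w.
        by rewrite eq_sym (negbTE vw) addr0 subr_ge0 ge_min lexx orbT.
      by rewrite addr0 addr_ge0 //; case: ifP => // _; exact: ltW.
    + rewrite col; have := lc x xU; case: eqP => [->|_]; case: eqP => _; lra.
    + rewrite /lam' /bump lU // add0r.
      have /negbTE-> : x != v by apply: contraNneq xU => ->.
      have /negbTE-> : x != w by apply: contraNneq xU => ->.
      by rewrite !andbF addr0.
    + rewrite /lam' !sum_bump_row vU wU !andbT; have := lr g; case: eqP => _; lra.
  - by rewrite !value_bump ?inE ?wp ?vp // addrK.
  - move=> g x xp; rewrite /lam' /bump lpath // add0r.
    case: eqP => [gf|_] /=; last by rewrite addr0.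
    have /negbTE-> : x != v by apply: contraNneq xp => ->; rewrite gf.
    have /negbTE-> : x != w by apply: contraNneq xp => ->; rewrite gf.
    by rewrite addr0.
by rewrite slack' cardsU1 lcard inE wU /= -leNgt wsat ltnn.
Qed.

(** Take for [W] the unsaturated nodes of a tight maximizer. The nodes of [U :\: W] are saturated,
    the flows meeting [W] are fully served inside [W], and no other flow uses [W], so the value
    splits into the two terms of the cut. *)
Lemma R3_eq_cut (U : {set V}) : exists2 W : {set V}, W \subset U & R3 path rate c U = cut U W.
Proof.
have [lam [[l0 lc lU lr] <- lpath tight]] := exists_tight U.
pose W := [set v in U | \sum_(f : F) lam f v < c v]%SET.
exists W; first by apply/subsetP => v; rewrite inE => /andP[].
have rowU f : \sum_(v in path f :&: U) lam f v = \sum_(v in U) lam f v.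
  rewrite [RHS](big_setID (path f)) /= setIC [X in _ + X]big1 ?addr0 // => v.
  by rewrite inE => /andP[/lpath].
rewrite /value (eq_bigr _ (fun f _ => rowU f)).
have -> : \sum_f \sum_(v in U) lam f v =
    \sum_f \sum_(v in U :\: W) lam f v + \sum_f \sum_(v in W) lam f v.
  rewrite -big_split /=; apply: eq_bigr => f _.
  rewrite (big_setID W) /= addrC; congr (_ + _); apply: eq_bigl => v.
  by rewrite !inE; case: (v \in U).
congr (_ + _).
  rewrite exchange_big /=; apply: eq_bigr => v; rewrite !inE => /andP[vW vU].
  by apply/eqP; rewrite eq_le lc //= leNgt; rewrite vU in vW.
rewrite (bigID (mem (nbr W))) /= addrC big1 => [|f fN]; last first.
  apply: big1 => v vW; apply: lpath; apply: contraL vW; exact: notin_nbr.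
rewrite add0r; apply: eq_bigr => f; rewrite inE => /set0Pn[v].
rewrite !inE => /and3P[vp vU vsl]; have [<- full] := tight f v vU vsl vp.
rewrite [RHS](big_setID W) /= [X in _ = _ + X]big1 ?addr0 => [|w].
  by apply: eq_bigl => w; rewrite !inE; case: (w \in U).
rewrite !inE => /andP[wW wU]; apply/eqP; rewrite eq_le l0 andbT leNgt.
by apply/negP => /(full w wU) h; rewrite wU h in wW.
Qed.

Lemma nbrS (W W' : {set V}) : W \subset W' -> nbr W \subset nbr W'.
Proof.
move=> WW'; apply/subsetP => f; rewrite !inE => /set0Pn[v]; rewrite inE => /andP[vp vW].
by apply/set0Pn; exists v; rewrite inE vp (subsetP WW').
Qed.

(** A minimal cut of [U'], intersected with [U], is a cut of [U] of no larger capacity. *)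
Lemma R3_mono (U U' : {set V}) : U \subset U' -> R3 path rate c U <= R3 path rate c U'.
Proof.
move=> UU'; have [W WU ->] := R3_eq_cut U'; apply: le_trans (R3_le_cut U (W :&: U)) _.
apply: lerD; apply: sum_le_subset => [x|]; rewrite ?ltW //.
  by apply/subsetP => v; rewrite !inE => /andP[+ vU]; rewrite vU andbT (subsetP UU') // andbT.
exact/nbrS/subsetIl.
Qed.

Lemma R3_ge0 (U : {set V}) : 0 <= R3 path rate c U.
Proof.
apply: le_trans (value_le_R3 (feasibleR3_0 U)); rewrite /value.
by apply: sumr_ge0 => f _; rewrite big1.
Qed.

Lemma R3_set0 : R3 path rate c set0 = 0.
Proof.
apply/eqP; rewrite eq_le R3_ge0 andbT; apply: le_trans (R3_le_cut set0 set0) _.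
by rewrite /cut set0D big_set0 add0r big1 // => f; rewrite inE setI0 eqxx.
Qed.

(* A minimal cut of [A :|: B] and of [A :&: B] is obtained by uniting and
   intersecting minimal cuts of [A] and [B]. *)
Lemma R3_submodular (A B : {set V}) :
  R3 path rate c (A :|: B) + R3 path rate c (A :&: B) <= R3 path rate c A + R3 path rate c B.
Proof.
have [W WA ->] := R3_eq_cut A; have [X XB ->] := R3_eq_cut B.
apply: le_trans (lerD (R3_le_cut _ (W :|: X)) (R3_le_cut _ (W :&: X))) _.
rewrite /cut addrACA [leRHS]addrACA; apply: lerD.
  rewrite ![\sum_(v in _ :\: _) _]big_mkcond -!big_split /=; apply: ler_sum => v _.
  have := subsetP WA v; have := subsetP XB v; have := c_gt0 v; rewrite !inE.
  by do 4![case: (_ \in _) => /=] => ? h1 h2; rewrite ?addr0 ?add0r ?lexx //;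
    first [have // := h1 isT | have // := h2 isT | lra].
(* A flow meeting [W :|: X] meets one of the two sets, and a flow meeting [W :&: X] meets both. *)
rewrite ![\sum_(f in nbr _) _]big_mkcond -!big_split /=; apply: ler_sum => f _.
have := rate_gt0 f; have NU : f \in nbr (W :|: X) -> (f \in nbr W) || (f \in nbr X).
  rewrite !inE setIUr => /set0Pn[v]; rewrite inE => /orP[] h; apply/orP; [left|right];
  by apply/set0Pn; exists v.
have NI1 := subsetP (nbrS (subsetIl W X)) f; have NI2 := subsetP (nbrS (subsetIr W X)) f.
move: NU NI1 NI2; do 4![case: (f \in _) => /=] => h1 h2 h3 ?;
  first [lra | have // := h1 isT | have // := h2 isT | have // := h3 isT].
Qed.

(** An allocation of P1 may exceed the rate of a flow and so be infeasible for the relaxation. It is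
    therefore compared with a minimal cut: counted flows off [nbr W] are charged to capacities, the
    others to their rates. *)
Lemma J1_le_R3 (b : V -> R) (B : R) (U : {set V}) lam :
  feasibleP1 c b B U lam -> J1 path rate U lam <= R3 path rate c U.
Proof.
case=> l0 lc lU _; have [W WU ->] := R3_eq_cut U.
rewrite /J1 (bigID (mem (nbr W))) /= addrC; apply: lerD.
  apply: le_trans (sum_off_nbr_le W l0 lc).
  by apply: ler_sum => f _; case: ifP => // _; exact: sumr_ge0.
by apply: ler_sum => f _; case: ifP => // _; exact: ltW.
Qed.

End Relaxation.

(** * Greedy placement *)

Section SubmodularGreedy.
Context {V : finType} {R : realType}.
Variables (g : {set V} -> R) (b : V -> R).
Hypotheses (g_mono : forall S T : {set V}, S \subset T -> g S <= g T)
  (g_submod : forall S T : {set V}, g (S :|: T) + g (S :&: T) <= g S + g T)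
  (g_set0 : g set0 = 0) (b_gt0 : forall v, 0 < b v).
Implicit Types (S T O : {set V}) (u v : V).

(** Submodularity for [u |: S] and [T], whose intersection contains [S]; monotonicity covers at once
    the cases [u] in [T] and [u] outside [T]. *)
Lemma marginal_le S T u : S \subset T -> g (u |: T) - g T <= g (u |: S) - g S.
Proof.
move=> ST; have := g_submod (u |: S) T.
rewrite -setUA (setUidPr ST) => h.
have : g S <= g ((u |: S) :&: T) by apply: g_mono; rewrite subsetI subsetUr.
lra.
Qed.

Lemma union_le_sum_marginals S T :
  g (S :|: T) - g S <= \sum_(v in T) (g (v |: S) - g S).
Proof.
have [n] := ubnP #|T|; elim: n T => // n IH T leTn.
have [->|[v vT]] := set_0Vmem T; first by rewrite setU0 big_set0 subrr.
rewrite (big_setD1 v) //=; have := IH (T :\ v).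
rewrite (cardsD1 v) vT in leTn; move=> /(_ leTn) h.
have := @marginal_le S (S :|: (T :\ v)) v (subsetUl _ _).
by rewrite setUCA setD1K //; lra.
Qed.

(** Completing [S] by the missing part of [O] costs at most [D] and gains at most [rho] per unit of
    cost. *)
Lemma gap_le_density S O (rho D : R) : 0 <= rho ->
  (forall v, v \in O :\: S -> g (v |: S) - g S <= rho * b v) ->
  \sum_(v in O :\: S) b v <= D -> g O - g S <= rho * D.
Proof.
move=> r0 hr hD; apply: (@le_trans _ _ (g (S :|: (O :\: S)) - g S)).
  by rewrite lerD2r g_mono //; apply/subsetP => v; rewrite !inE => ->; rewrite andbT orbN.
apply: le_trans (union_le_sum_marginals _ _) _; apply: le_trans (ler_wpM2l r0 hD).
by rewrite mulr_sumr; apply: ler_sum.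
Qed.

(** The density of [u] is at least the gap divided by [D], so the gap shrinks by [1 - b u / D],
    which is at most the exponential. Exponential factors multiply along a run, so that only the
    total cost matters. The bound [E] stays nonnegative even when the gap does not. *)
Lemma gap_step S O u (D E : R) : 0 < D ->
  (forall v, v \in O :\: S ->
     (g (v |: S) - g S) / b v <= (g (u |: S) - g S) / b u) ->
  \sum_(v in O :\: S) b v <= D ->
  0 <= E -> g O - g S <= E -> g O - g (u |: S) <= expR (- (b u / D)) * E.
Proof.
move=> D0 hu hD E0 hE.
have m0 v : 0 <= g (v |: S) - g S by rewrite subr_ge0 g_mono // subsetUr.
have [neg|pos] := ltP (g O - g S) 0.
  apply: (@le_trans _ _ 0); last by rewrite mulr_ge0 ?expR_ge0.
  by have := m0 u; lra.
have gap : g O - g S <= (g (u |: S) - g S) / b u * D.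
  apply: gap_le_density hD => [|v /hu]; first by rewrite divr_ge0 ?m0 // ltW.
  by rewrite ler_pdivrMr.
have {}gap : (g O - g S) * (b u / D) <= g (u |: S) - g S.
  by rewrite -ler_pdivlMr ?divr_gt0 // invf_div mulrA mulrAC.
apply: le_trans (ler_wpM2l (expR_ge0 _) hE).
apply: (@le_trans _ _ ((1 - b u / D) * (g O - g S))); first by lra.
by rewrite ler_wpM2r // expR_ge1Dx.
Qed.

(* A set of at least three elements contains a triple [Y] of which every further
   element gains at most a third: collect the first three greedy choices. *)
Lemma exists_triple O : (2 < #|O|)%N -> exists Y : {set V},
  [/\ Y \subset O, #|Y| = 3%N &
      forall v S, v \in O :\: Y -> Y \subset S -> g (v |: S) - g S <= g Y / 3].
Proof.
move=> O3.
have best S : (#|S| < 3)%N -> S \subset O -> exists u, [/\ u \in O, u \notin S &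
    forall v, v \in O :\: S -> g (v |: S) <= g (u |: S)].
  move=> S3 SO; have /card_gt0P[u0 u0P] : (0 < #|O :\: S|)%N.
    by rewrite cardsD (setIidPr SO) subn_gt0 (leq_ltn_trans _ O3).
  case: (@arg_maxP _ _ V u0 (fun u => u \in O :\: S) (fun u => g (u |: S)) u0P) => u /=.
  rewrite inE => /andP[uS uO] umax.
  by exists u; split=> // v vP; apply: umax.
have [|x [xO _ xmax]] := best set0 _ (sub0set _); first by rewrite cards0.
have xO' : [set x] \subset O by rewrite sub1set.
have [|y [yO yx ymax]] := best [set x] _ xO'; first by rewrite cards1.
have yO' : y |: [set x] \subset O by rewrite subUset sub1set yO.
have cy : #|y |: [set x]| = 2%N by rewrite cardsU1 yx cards1.
have [|z [zO zy zmax]] := best (y |: [set x]) _ yO'; first by rewrite cy.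
exists (z |: (y |: [set x])); split.
- by rewrite subUset sub1set zO.
- by rewrite cardsU1 zy cy.
move=> v S; rewrite inE => /andP[vY vO] YS.
have vP T : T \subset z |: (y |: [set x]) -> v \in O :\: T.
  by move=> TY; rewrite inE vO andbT; apply: contra vY; exact: (subsetP TY).
have s2 : y |: [set x] \subset z |: (y |: [set x]) := subsetUr _ _.
have s1 : [set x] \subset z |: (y |: [set x]) := subset_trans (subsetUr _ _) s2.
(* The element [v] was a candidate at each of the three choices. By diminishing returns each of
   their gains, which telescope to [g Y], is at least the gain of [v] over [S]. *)
have := xmax v (vP _ (sub0set _)); rewrite !setU0.
have := ymax v (vP _ s1); have := zmax v (vP _ s2).
have := marginal_le v (subset_trans s2 YS).
have := marginal_le v (subset_trans s1 YS).
by have := marginal_le v (sub0set S); rewrite setU0 g_set0; lra.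
Qed.

End SubmodularGreedy.

(** * Guarantees of the uniform and the enumerative placement *)

Section Placement.
Context {V F : finType} {R : realType}.
Variables (path : F -> {set V}) (rate : F -> R) (c b : V -> R) (B : R).
Hypotheses (rate_gt0 : forall f, 0 < rate f) (c_gt0 : forall v, 0 < c v)
  (b_gt0 : forall v, 0 < b v) (B_ge0 : 0 <= B).
Implicit Types (S T U W O Y : {set V}) (u v : V).
Let r := R3 path rate c.

Let r_mono S T : S \subset T -> r S <= r T.
Proof. exact: R3_mono. Qed.

Let r_submod S T : r (S :|: T) + r (S :&: T) <= r S + r T.
Proof. exact: R3_submodular. Qed.

Let r_set0 : r set0 = 0.
Proof. exact: R3_set0. Qed.

Let r_ge0 S : 0 <= r S.
Proof. exact: R3_ge0. Qed.

Lemma cost_setU1 S u : u \notin S -> cost b (u |: S) = b u + cost b S.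
Proof. exact: big_setU1. Qed.

Lemma cost_setD S T : S \subset T -> \sum_(v in T :\: S) b v = cost b T - cost b S.
Proof.
by move=> ST; rewrite /cost [X in _ = X - _](big_setID S) /= (setIidPr ST) addrAC subrr add0r.
Qed.

Lemma cost_setD_le O S : \sum_(v in O :\: S) b v <= cost b O.
Proof. by apply: sum_le_subset => [v|]; [exact: ltW | exact: subsetDl]. Qed.

Lemma sg_out_cost b0 k S W : (forall v, b v = b0) -> 0 <= b0 ->
  sg_out path rate c k S W -> cost b W <= cost b S + b0 *+ k.
Proof.
move=> bE b0_ge0; elim=> [{}S|{}k {}S _|{}k {}S S' {}W [u [uS -> _]] _ IH].
- by rewrite addr0.
- by rewrite lerDl mulrn_wge0.
- by apply: le_trans IH _; rewrite cost_setU1 // bE mulrS addrA [b0 + _]addrC.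
Qed.

Lemma sg_out_gap b0 k S W O (D E : R) : (forall v, b v = b0) ->
  0 < D -> cost b O <= D -> sg_out path rate c k S W ->
  0 <= E -> r O - r S <= E -> r O - r W <= expR (- (k%:R * (b0 / D))) * E.
Proof.
move=> bE D0 hD out.
elim: out E => [{}S|{}k {}S ->|{}k {}S S' {}W [u [uS -> umax]] _ IH] E E0 hE.
- by rewrite mul0r oppr0 expR0 mul1r.
(* The run stopped early with all nodes placed, so the gap is nonpositive. *)
- apply: (@le_trans _ _ 0); last by rewrite mulr_ge0 ?expR_ge0.
  by rewrite subr_le0 r_mono // subsetT.
- rewrite -natr1 mulrDl mul1r opprD expRD -mulrA; apply: IH; first by rewrite mulr_ge0 ?expR_ge0.
  rewrite -(bE u); apply: (gap_step r_mono r_submod b_gt0) => //.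
    move=> v; rewrite inE => /andP[vS _]; rewrite !bE.
    by rewrite ler_wpM2r ?umax // invr_ge0 -(bE u) ltW.
  exact: le_trans (cost_setD_le _ _) hD.
Qed.

(** With [k] the number of steps, a feasible [O] has at most [k] elements, so [D] can be [k%:R * b0]
    rather than [B]. The exponent is then exactly [-1], with no rounding loss. *)
Lemma sg_out_guarantee b0 W O : (forall v, b v = b0) ->
  sg_out path rate c (Num.truncn (B / b0)) set0 W ->
  cost b W <= B /\ (cost b O <= B -> (1 - expR (-1)) * r O <= r W).
Proof.
(* Without nodes, nothing forces the common cost [b0] to be positive. *)
move=> bE out; have [V0|[v _]] := set_0Vmem [set: V].
  have triv (S : {set V}) : S = set0 by apply/eqP; rewrite -subset0 -V0 subsetT.
  by rewrite (triv W) (triv O) /cost big_set0 r_set0 mulr0.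
have b0_gt0 : 0 < b0 by rewrite -(bE v).
have q0 : 0 <= B / b0 by rewrite divr_ge0 // ltW.
set k := Num.truncn _ in out.
have kB : b0 *+ k <= B.
  by rewrite -mulr_natl -ler_pdivlMr // truncn_le.
split; first by apply: le_trans (sg_out_cost bE (ltW b0_gt0) out) _; rewrite /cost big_set0 add0r.
have costE S : cost b S = #|S|%:R * b0.
  by rewrite /cost (eq_bigr (fun=> b0)) ?sumr_const ?mulr_natl // => u _; exact: bE.
move=> OB; have Ok : (#|O| <= k)%N.
  by rewrite truncn_ge_nat ?q0 // ler_pdivlMr // -costE.
have [k0|k0] := posnP k.
  have -> : O = set0 by apply/eqP; rewrite -cards_eq0 -leqn0 -k0.
  by rewrite r_set0 mulr0.
have D0 : 0 < k%:R * b0 by rewrite mulr_gt0 ?ltr0n.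
have OD : cost b O <= k%:R * b0.
  by rewrite costE; apply: ler_wpM2r; [exact: ltW | rewrite ler_nat].
have /(_ _ (r_ge0 O)) := sg_out_gap bE D0 OD out.
by rewrite r_set0 subr0 => /(_ (lexx _)); rewrite mulrA divff ?gt_eqF //; lra.
Qed.

Lemma aug_out_cost S W : aug_out path rate c b B S W -> cost b S <= B -> cost b W <= B.
Proof. by elim=> // {}S S' {}W [u [_ uB -> _]] _ IH _; exact: IH. Qed.

Lemma aug_out_sub S W : aug_out path rate c b B S W -> S \subset W.
Proof.
by elim=> // {}S S' {}W [u [_ _ -> _]] _; apply: subset_trans; exact: subsetUr.
Qed.

(* As long as the densest missing element of [O] fits in the budget, the greedy
   choice is at least as dense and the gap to [O] decays exponentially in the
   money spent. When it does not fit, adding it anyway would exhaust the budget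
   left by [Y] and close the gap to a factor [1/e], and it gains at most
   [r Y / 3 <= r Y / e]. *)
Lemma aug_out_gap Y O S W : Y \subset O -> cost b O <= B ->
  (forall v T, v \in O :\: Y -> Y \subset T -> r (v |: T) - r T <= r Y / 3) ->
  aug_out path rate c b B S W -> Y \subset S -> cost b S <= B ->
  r O - r S <= expR (- ((cost b S - cost b Y) / (B - cost b Y))) * (r O - r Y) ->
  (1 - expR (-1)) * r O <= r W.
Proof.
move=> YO OB small out.
have gap0 : 0 <= r O - r Y by rewrite subr_ge0 r_mono.
pose D := B - cost b Y; rewrite -/D.
have D_gt0 v S' : Y \subset S' -> v \in O :\: S' -> 0 < D.
  move=> YS' ; rewrite inE => /andP[vS' vO].
  have vY : v \notin Y by apply: contra vS'; exact: (subsetP YS').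
  have : cost b (v |: Y) <= cost b O.
    by apply: sum_le_subset => [x|]; [exact: ltW | rewrite subUset sub1set vO].
  by rewrite cost_setU1 // /D; have := b_gt0 v; lra.
(* The budget is not mentioned here: the step applies to actual greedy choices and to the
   hypothetical purchase of an element that does not fit. *)
have step S' u : Y \subset S' -> u \notin S' -> 0 < D ->
    (forall v, v \in O :\: S' ->
      (r (v |: S') - r S') / b v <= (r (u |: S') - r S') / b u) ->
    r O - r S' <= expR (- ((cost b S' - cost b Y) / D)) * (r O - r Y) ->
    r O - r (u |: S') <= expR (- ((cost b (u |: S') - cost b Y) / D)) * (r O - r Y).
  move=> YS' uS' D0 umax hS'.
  rewrite cost_setU1 // -addrA mulrDl opprD expRD -mulrA.
  apply: (gap_step r_mono r_submod b_gt0) hS' => //; last by rewrite mulr_ge0 ?expR_ge0.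
  apply: (@le_trans _ _ (\sum_(v in O :\: Y) b v)); last by rewrite cost_setD // lerD2r.
  by apply: sum_le_subset => [x|]; [exact: ltW | exact: setDS].
have densest S' : O \subset S' \/ exists2 v, v \in O :\: S' &
    forall w, w \in O :\: S' ->
      (r (w |: S') - r S') / b w <= (r (v |: S') - r S') / b v.
  have [/eqP|[v0 v0P]] := set_0Vmem (O :\: S'); first by rewrite setD_eq0; left.
  right; case: (@arg_maxP _ _ V v0 (fun v => v \in O :\: S')
    (fun v => (r (v |: S') - r S') / b v) v0P) => v vP vmax.
  by exists v => // w; exact: vmax.
have covered S' : S' \subset W -> O \subset S' -> (1 - expR (-1)) * r O <= r W.
  move=> S'W OS'; apply: (@le_trans _ _ (r O)); last exact/r_mono/(subset_trans OS').
  by have := mulr_ge0 (expR_ge0 (-1)) (r_ge0 O); lra.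
have overflow S' v : S' \subset W -> Y \subset S' -> v \in O :\: S' ->
    (forall w, w \in O :\: S' ->
      (r (w |: S') - r S') / b w <= (r (v |: S') - r S') / b v) ->
    B < cost b (v |: S') ->
    r O - r S' <= expR (- ((cost b S' - cost b Y) / D)) * (r O - r Y) ->
    (1 - expR (-1)) * r O <= r W.
  move=> S'W YS' vP vmax vB hS'; have D0 := D_gt0 v S' YS' vP.
  have [vS' vO] : v \notin S' /\ v \in O by move: vP; rewrite inE => /andP.
  have := step S' v YS' vS' D0 vmax hS'.
  have : expR (- ((cost b (v |: S') - cost b Y) / D)) <= expR (-1).
    by rewrite ler_expR lerN2 ler_pdivlMr // mul1r lerD2r ltW.
  move=> /(ler_wpM2r gap0).
  have vY : v \in O :\: Y by rewrite inE vO andbT; apply: contra vS'; exact: (subsetP YS').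
  (* The gain [r Y / 3] of the element that does not fit is paid by the term [expR (-1) * r Y],
     available because the initial gap is [r O - r Y] and not [r O]. *)
  have := small v S' vY YS'; have := r_mono S'W.
  have : 3^-1 * r Y <= expR (-1) * r Y by rewrite ler_wpM2r // expRN1_ge_third.
  by lra.
elim: out densest covered overflow => [{}S Sfull|{}S S' {}W [u [uS uB -> umax]] out IH]
    densest covered overflow YS SB hS.
  have [|[v vP vmax]] := densest S; first exact: covered.
  apply: (overflow S v) => //; apply: Sfull.
  by move: vP; rewrite inE => /andP[].
have SW : S \subset W by apply: subset_trans (aug_out_sub out); exact: subsetUr.
have [|[v vP vmax]] := densest S; first exact: covered.
have [vB|vB] := ltP B (cost b (v |: S)); first exact: (overflow S v).
apply: IH => //; first exact: subset_trans (subsetUr _ _).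
apply: step => //; first exact: D_gt0 vP.
(* The element [w] may exceed the budget, so the comparison passes through the affordable [v]. *)
move=> w wP; apply: le_trans (vmax w wP) _.
by apply: umax => //; move: vP; rewrite inE => /andP[].
Qed.

(** If [O] has at least three elements, the enumeration reaches the triple [Y] of [exists_triple],
    affordable as a part of [O]. A smaller nonempty [O] is itself among the sets enumerated for
    [U1]. *)
Lemma eg_out_guarantee W O : eg_out path rate c b B W ->
  cost b W <= B /\ (cost b O <= B -> (1 - expR (-1)) * r O <= r W).
Proof.
case=> U1 [U2 [U1P U2P UW]].
have set0B : cost b set0 <= B by rewrite /cost big_set0.
have U1B : cost b U1 <= B by case: U1P => [[[_ ?] _]|[_ ->]].
have U2B : cost b U2 <= B.
  case: U2P => [[g [gP [S0 [S0P -> _]]]]|[_ ->]] //.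
  by case: (S0P) => _; exact: aug_out_cost (gP _ S0P).
split; first by case: UW => -[->].
move=> OB; have [rW1 rW2] : r U1 <= r W /\ r U2 <= r W by case: UW => -[-> h].
have shrink x : r O <= x -> (1 - expR (-1)) * r O <= x.
  by move=> h; have := mulr_ge0 (expR_ge0 (-1)) (r_ge0 O); lra.
have [cO3|cO3] := ltnP 2 #|O|.
  have [Y [YO Y3 small]] := exists_triple r_mono r_submod r_set0 cO3.
  have YB : cost b Y <= B.
    by apply: le_trans OB; apply: sum_le_subset => // x; exact: ltW.
  have Y3P : three_feas b B Y by [].
  case: U2P => [[g [gP [S0 [S0P U2E gmax]]]]|[none _]]; last by case: (none Y).
  apply: le_trans rW2; apply: le_trans (gmax Y Y3P).
  apply: (aug_out_gap YO OB small (gP Y Y3P)) => //.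
  by rewrite subrr mul0r oppr0 expR0 mul1r.
apply: shrink; have [->|O0] := eqVneq O set0; first by rewrite r_set0 r_ge0.
have OP : small_feas b B O.
  by split=> //; move: cO3 O0; rewrite -cards_eq0; case: #|O| => [|[|[|]]].
case: U1P => [[_ U1max]|[none _]]; last by case: (none O).
by apply: le_trans rW1; exact: U1max.
Qed.

Lemma placement_guarantee W O : placement path rate c b B W ->
  cost b W <= B /\ (cost b O <= B -> (1 - expR (-1)) * r O <= r W).
Proof.
by case=> [[b0 [bE]]|[_]]; [exact: sg_out_guarantee | exact: eg_out_guarantee].
Qed.

End Placement.

(** * Capacity allocation *)

Section Allocation.
Context {V F : finType} {R : realType}.
Variables (path : F -> {set V}) (rate : F -> R) (c : V -> R) (U : {set V}).
Hypotheses (rate_gt0 : forall f, 0 < rate f) (c_gt0 : forall v, 0 < c v)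
  (rate_le : forall f v, rate f <= c v).
Implicit Types (s : @gstate V F R) (f : F) (v : V).

(** Service is all or nothing, and [gcap] records exactly the capacity left by the loads. *)
Record gca_inv s : Prop := GcaInv {
  inv_lam_ge0 : forall f v, 0 <= glam s f v;
  inv_off : forall f v, v \notin path f :&: U -> glam s f v = 0;
  inv_unassigned : forall f v, ~~ gasg s f -> glam s f v = 0;
  inv_assigned : forall f, gasg s f -> \sum_(v in path f :&: U) glam s f v = rate f;
  inv_cap_ge0 : forall v, 0 <= gcap s v;
  inv_load : forall v, \sum_f glam s f v = c v - gcap s v }.

Definition gca_le s s' : Prop :=
  (forall v, gcap s' v <= gcap s v) /\ (forall f, gasg s f -> gasg s' f).

Lemma gca_le_trans s s' s'' : gca_le s s' -> gca_le s' s'' -> gca_le s s''.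
Proof. by move=> [h1 h2] [h3 h4]; split=> [v|f /h2/h4 //]; apply: le_trans (h1 v). Qed.

(** The common form of both phases: a Phase I assignment is a split concentrated at one node. *)
Definition assign f (x : V -> R) s : @gstate V F R :=
  GState (fun g w => if g == f then x w else glam s g w)
         (fun w => gcap s w - x w) (fun g => (g == f) || gasg s g).

Lemma assign_inv f x s : ~~ gasg s f -> (forall v, 0 <= x v) ->
  (forall v, x v <= gcap s v) -> (forall v, v \notin path f :&: U -> x v = 0) ->
  \sum_v x v = rate f -> gca_inv s -> gca_inv (assign f x s) /\ gca_le s (assign f x s).
Proof.
move=> fN x0 xcap xoff xsum [l0 loff lun las cap0 load]; split; last first.
  by split=> [v|g /= ->]; [rewrite /= gerBl | rewrite orbT].
split=> /= [g v|g v|g v|g|v|v].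
- by case: ifP.
- by case: eqP => [->|_]; [exact: xoff | exact: loff].
- by case: eqP => //= _; exact: lun.
- case: eqP => [-> _|_ /=]; last exact: las.
  by rewrite -xsum [RHS](bigID (mem (path f :&: U))) /= [X in _ + X]big1 ?addr0.
- by rewrite subr_ge0.
- rewrite opprB addrA addrAC -load (bigD1 f) //= eqxx addrC; congr (_ + _).
  rewrite [RHS](bigD1 f) //= lun // add0r.
  by apply: eq_bigr => g /negbTE->.
Qed.

Lemma phase1_step_inv f s s' : ~~ gasg s f -> phase1_step path rate U f s s' ->
  gca_inv s -> gca_inv s' /\ gca_le s s'.
Proof.
move=> fN [[v [vP vcap ->]]|[_ ->]] sI; last by split.
pose x w := if w == v then rate f else 0.
have -> : GState (fun g w => if (g == f) && (w == v) then rate f else glam s g w)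
    (fun w => if w == v then gcap s v - rate f else gcap s w)
    (fun g => (g == f) || gasg s g) = assign f x s.
  rewrite /assign /x; congr GState.
    apply/funext => g; apply/funext => w.
    (* Overwriting one entry agrees with overwriting the whole row, since the row of the unassigned
       [f] is zero. *)
    by case: eqP => [->|//] /=; case: eqP => // _; rewrite (inv_unassigned sI).
  by apply/funext => w; case: eqP => [->|_]; rewrite ?subr0.
apply: assign_inv => //.
- by move=> w; rewrite /x; case: ifP => // _; exact: ltW.
- by move=> w; rewrite /x; case: eqP => [->|_] //; exact: (inv_cap_ge0 sI).
- by move=> w; rewrite /x; case: eqP => [->|//]; rewrite vP.
- by rewrite /x -big_mkcond big_pred1_eq.
Qed.

Lemma phase2_step_inv f s s' : phase2_step path rate U f s s' ->
  gca_inv s -> gca_inv s' /\ gca_le s s'.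
Proof.
case=> [[_ ->]|[[fN [_ [x [x0 xcap xoff xsum ->]]]]|[_ [_ ->]]]] sI; try by split.
exact: assign_inv.
Qed.

Lemma phase2_run_inv order s s' : run (phase2_step path rate U) order s s' ->
  gca_inv s -> gca_inv s' /\ gca_le s s'.
Proof.
elim=> [{}s|f fs {}s s1 {}s' st _ IH] sI; first by split.
have [s1I le1] := phase2_step_inv st sI; have [s'I le'] := IH s1I.
by split=> //; exact: gca_le_trans le'.
Qed.

(* A flow [f] that Phase I fails to place finds less than [rate f] left at each
   of its nodes; as [rate f <= c v], such a node already hosts an earlier, hence
   larger, flow, so it is at least half full. *)
Lemma phase1_run_inv order s s' : run (phase1_step path rate U) order s s' ->
  uniq order -> sorted (fun f g => rate g <= rate f) order ->
  (forall f, f \in order -> ~~ gasg s f) -> gca_inv s ->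
  (forall v f, f \in order -> gcap s v = c v \/ rate f <= c v - gcap s v) ->
  [/\ gca_inv s', gca_le s s' & forall f v, f \in order -> ~~ gasg s' f ->
      v \in path f :&: U -> 2 * gcap s' v <= c v].
Proof.
elim=> [{}s|f fs {}s s1 {}s' st _ IH] //= /andP[ffs ufs] sfs sN sI hos.
have [s1I le1] := phase1_step_inv (sN f (mem_head _ _)) st sI.
have fmax g : g \in fs -> rate g <= rate f.
  move=> gfs; have tr : transitive (fun f g => rate g <= rate f).
    by move=> y x z xy yz; exact: le_trans yz xy.
  by have /allP/(_ g gfs) := order_path_min tr sfs.
have s1N g : g \in fs -> ~~ gasg s1 g.
  move=> gfs; have gN := sN g; rewrite inE gfs orbT in gN.
  case: st => [[v [_ _ ->]]|[_ ->]] /=; last exact: gN.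
  by rewrite negb_or gN // andbT; apply: contraNneq ffs => <-.
have capc v : gcap s v <= c v.
  have : 0 <= \sum_g glam s g v by apply: sumr_ge0 => g _; exact: (inv_lam_ge0 sI).
  by rewrite (inv_load sI) subr_ge0.
(* Only the node receiving [f] changes, and its load becomes at least [rate f], hence at least
   [rate g] for every later [g]. *)
have hos1 v g : g \in fs -> gcap s1 v = c v \/ rate g <= c v - gcap s1 v.
  move=> gfs; have := hos v g; rewrite inE gfs orbT => /(_ isT).
  case: st => [[w [_ _ ->]]|[_ ->]] //=; case: eqP => // <- _; right.
  by have := capc v; have := fmax g gfs; lra.
have [s'I le' half] := IH ufs (path_sorted sfs) s1N s1I hos1.
split=> // [|g v]; first exact: gca_le_trans le'.
rewrite inE => /orP[/eqP->|]; last exact: half.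
move=> fN vP; case: st => [[w [_ _ s1E]]|[full s1E]].
  by move: fN; rewrite le'.2 // s1E /= eqxx.
have := full v vP; have := le'.1 v; rewrite s1E.
by have := rate_le f v; case: (hos v f (mem_head _ _)) => [->|]; lra.
Qed.

Lemma gca_init_inv : gca_inv (gca_init c).
Proof.
by split=> //= [v|v]; [exact: ltW | rewrite big1 ?subrr].
Qed.

(** Phase II only lowers remaining capacities and only adds served flows, so the half-full property
    survives from Phase I. *)
Lemma gca_out_spec lam : gca_out path rate c U lam -> exists s,
  [/\ lam = glam s, gca_inv s & forall f v, ~~ gasg s f -> v \in path f :&: U ->
      2 * gcap s v <= c v].
Proof.
case=> order [s1 [s2 [perm srt run1 run2 ->]]]; exists s2.
have [|||s1I le1 half] := phase1_run_inv run1 _ srt _ gca_init_inv _ => //.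
- by rewrite (perm_uniq perm) enum_uniq.
- by move=> v f _; left.
have [s2I le2] := phase2_run_inv run2 s1I.
split=> // f v fN vP; have := half f v.
have -> : f \in order by rewrite (perm_mem perm) mem_enum inE; apply/set0Pn; exists v.
have fN1 : ~~ gasg s1 f by apply: contra fN; exact: le2.2.
by move=> /(_ isT fN1 vP); have := le2.1 v; lra.
Qed.

(* The cut charging the served flows by rate, and the nodes of the unserved
   flows, which are half full, by capacity. *)
Lemma R3_le_3J1 lam : gca_out path rate c U lam ->
  R3 path rate c U <= 3 * J1 path rate U lam.
Proof.
case/gca_out_spec=> s [-> sI half].
pose Z := [set v in U | [exists f, ~~ gasg s f && (v \in path f)]]%SET.
pose L := \sum_(f | gasg s f) rate f.
have LJ : L <= J1 path rate U (glam s).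
  rewrite /L /J1 big_mkcond /=; apply: ler_sum => f _.
  case: ifPn => [fA|_]; first by rewrite (inv_assigned sI) // lexx.
  by case: ifP => // _; exact: ltW.
(* Each node of [Z] carries at least half its capacity, and all loads together come from served
   flows. *)
have ZL : \sum_(v in Z) c v <= 2 * L.
  apply: (@le_trans _ _ (2 * \sum_(v in Z) \sum_f glam s f v)).
    rewrite mulr_sumr; apply: ler_sum => v; rewrite inE (inv_load sI).
    case/andP=> vU /existsP[f /andP[fN vp]]; have := half f v fN.
    by rewrite inE vp vU => /(_ isT); lra.
  rewrite ler_pM2l // exchange_big /= [leRHS]big_mkcond /=; apply: ler_sum => f _.
  case: ifPn => [fA|fN]; last by rewrite big1 // => v _; exact: (inv_unassigned sI).
  rewrite -(inv_assigned sI fA) [leRHS]big_mkcond /= [leLHS]big_mkcond /=.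
  apply: ler_sum => v _; case: ifPn => [_|_]; case: ifPn => [_|vN] //.
    by rewrite (inv_off sI).
  exact: (inv_lam_ge0 sI).
(* An unserved flow has all its placed nodes in [Z], so a flow meeting [U :\: Z] is served. *)
have NL : \sum_(f in nbr path (U :\: Z)) rate f <= L.
  rewrite [leRHS]big_mkcond [leLHS]big_mkcond /=; apply: ler_sum => f _.
  case: ifPn => [|_]; last by case: ifP => // _; exact: ltW.
  rewrite inE => /set0Pn[v]; rewrite !inE => /and3P[vp vZ vU].
  case: ifPn => // fN; move: vZ; rewrite vU /=; case/negP.
  by apply/existsP; exists f; rewrite fN.
apply: le_trans (R3_le_cut path rate_gt0 c_gt0 U (U :\: Z)) _.
rewrite /cut setDDr setDv set0U.
have -> : U :&: Z = Z by apply/setIidPr/subsetP => v; rewrite inE => /andP[].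
by lra.
Qed.

Lemma gca_out_feasible b B lam : cost b U <= B ->
  gca_out path rate c U lam -> feasibleP1 c b B U lam.
Proof.
move=> UB /gca_out_spec[s [-> sI _]]; split=> // [f v|v _|f v vU].
- exact: (inv_lam_ge0 sI).
- by rewrite (inv_load sI) gerBl (inv_cap_ge0 sI).
- by rewrite (inv_off sI) // inE (negbTE vU) andbF.
Qed.

End Allocation.

Theorem theorem3 (V F : finType) (R : realType)
  (path : F -> {set V}) (rate : F -> R) (c b : V -> R) (B : R) :
  (forall f, 0 < rate f) ->
  (forall v, 0 < c v) ->
  (forall v, 0 < b v) ->
  0 <= B ->
  (forall f v, rate f <= c v) ->
  forall (U : {set V}) (lam : F -> V -> R),
    rp_gca_out path rate c b B U lam ->
    feasibleP1 c b B U lam /\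
    3^-1 * (1 - expR (-1)) * OPT path rate c b B <= J1 path rate U lam.
Proof.
move=> rate_gt0 c_gt0 b_gt0 B_ge0 rate_le U lam [placed allocated].
have guarantee W := placement_guarantee rate_gt0 c_gt0 b_gt0 B_ge0 W placed.
split; first exact: gca_out_feasible (guarantee set0).1 allocated.
have R3J := R3_le_3J1 rate_gt0 c_gt0 rate_le allocated.
have e0 : 0 < 1 - expR (-1) :> R by rewrite subr_gt0 -[ltRHS]expR0 ltr_expR; lra.
suff : OPT path rate c b B <= (3 * J1 path rate U lam) / (1 - expR (-1)).
  by rewrite ler_pdivlMr //; lra.
(* The bound on the supremum needs a feasible point: the empty placement, affordable as [0 <= B]. *)
apply: ge_sup => [|_ [W [mu [muP ->]]]].
  exists (J1 path rate set0 (fun _ _ => 0)); exists set0, (fun _ _ => 0).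
  by split=> //; split=> // [v _|]; rewrite ?big1 /cost ?big_set0 // ltW.
(* For a competitor [W], its value is at most [R3] of [W]; the factor [1 - expR (-1)] brings this
   below [R3] of [U], which is at most three times the value achieved. *)
rewrite ler_pdivlMr // mulrC.
apply: le_trans R3J; case: (muP) => _ _ _ WB; apply: le_trans ((guarantee W).2 WB).
by rewrite ler_wpM2l ?(ltW e0) // (J1_le_R3 _ _ _ muP).
Qed.
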